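(* Let $\mathbb K$ be an arbitrary field and let $d\geqslant 2$ be an integer. Let $\mathcal A$ be a finite family of linear operators $\mathbb K^d\to\mathbb K^d$ containing an operator $A_0\in\mathcal A$ that has $d$ eigenvectors in $\mathbb K^d$ with pairwise different eigenvalues (in $\mathbb K$). Suppose that any $2d-1$ or fewer elements of $\mathcal A$ have a common non-trivial invariant subspace. Then there is a common non-trivial invariant subspace for all elements of $\mathcal A$.
   Context: A subspace $H\subseteq\mathbb K^d$ is invariant under a linear operator $A$ if $A(H)\subseteq H$. It is non-trivial if $H\neq\{\mathbf 0\}$ and $H\neq\mathbb K^d$. A common invariant subspace of several operators is a subspace invariant under each of them. *)

(* Defs.v *)
From HB Require Import structures.
From mathcomp Require Import all_boot all_order all_algebra.
Set Implicit Arguments.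
Unset Strict Implicit.
Unset Printing Implicit Defensive.
Import GRing.Theory.
Local Open Scope ring_scope.

Definition invariant_subspace (K : fieldType) (V : vectType K)
    (A : 'End(V)) (H : {vspace V}) : bool :=
  (A @: H <= H)%VS.

Definition nontrivial_subspace (K : fieldType) (V : vectType K) (H : {vspace V}) : bool :=
  (H != 0%VS) && (H != fullv).

Definition common_nontrivial_invariant (K : fieldType) (V : vectType K)
    (I : finType) (A : I -> 'End(V)) (J : {set I}) (H : {vspace V}) : Prop :=
  nontrivial_subspace H /\ (forall i, i \in J -> invariant_subspace (A i) H).

Definition eigenvector (K : fieldType) (V : vectType K)
    (A : 'End(V)) (a : K) (v : V) : Prop :=
  v != 0 /\ A v = a *: v.

Definition has_distinct_eigenvectors (K : fieldType) (V : vectType K)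
    (A : 'End(V)) (n : nat) : Prop :=
  exists (v : 'I_n -> V) (a : 'I_n -> K),
    injective a /\ (forall i, eigenvector A (a i) (v i)).

(* Main.v *)
(* In an eigenbasis of A_0 with distinct eigenvalues, the A_0-invariant subspaces
   are exactly the spans of subsets of the basis. Let each operator A_i define a
   digraph on the basis, with an edge j -> k when A_i v_j has a nonzero k-th
   coordinate; a span of basis vectors is A_i-invariant iff its index set is closed
   under these edges. If no proper nonempty set is closed under all the digraphs,
   their union is strongly connected, hence contains an out-tree and an in-tree
   spanning from a common root; these use at most 2(d-1) edges, so the operators
   carrying them, together with A_0, are at most 2d-1 operators without a common
   non-trivial invariant subspace. *)
Require Import Defs.
From HB Require Import structures.
From mathcomp Require Import all_boot all_order all_algebra.
Set Implicit Arguments.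
Unset Strict Implicit.
Unset Printing Implicit Defensive.
Import GRing.Theory.
Local Open Scope ring_scope.

Definition closed_under (I T : finType) (e : I -> rel T) (J : {set I})
    (S : {set T}) : bool :=
  [forall i in J, forall x in S, forall y, e i x y ==> (y \in S)].

Lemma closed_underP (I T : finType) (e : I -> rel T) (J : {set I}) (S : {set T}) :
  reflect (forall i x y, i \in J -> x \in S -> e i x y -> y \in S)
          (closed_under e J S).
Proof.
apply: (iffP forall_inP) => [cl i x y iJ xS exy|cl i iJ].
  by move/forall_inP/(_ x xS)/forallP/(_ y)/implyP: (cl i iJ); apply.
by apply/forall_inP=> x xS; apply/forallP=> y; apply/implyP; apply: cl.
Qed.

(** An edge leaving [S] is, reversed, an edge leaving the complement. This lets in-trees be treated
    as out-trees of the reversed digraphs. *)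
Lemma closed_underC (I T : finType) (e : I -> rel T) (J : {set I}) (S : {set T}) :
  closed_under (fun i x y => e i y x) J S = closed_under e J (~: S).
Proof.
apply/closed_underP/closed_underP=> cl i x y iJ.
  by rewrite !inE => xS exy; apply: contra xS => yS; apply: cl exy.
by move=> xS eyx; apply: contraLR xS => yS; rewrite -in_setC (cl i y) ?inE.
Qed.

Section StronglyConnected.

Variables (I T : finType) (e : I -> rel T).
Hypothesis e_strong :
  forall S : {set T}, closed_under e [set: I] S -> S = set0 \/ S = [set: T].

(** The out-tree from [r] is grown one edge at a time: [R] is its vertex set and [J] indexes
    digraphs carrying its edges, so each new vertex costs at most one index. *)
Lemma spanning_family_grow (r : T) (n : nat) : (n < #|T|)%N ->
  exists (J : {set I}) (R : {set T}),
    [/\ (#|J| <= n)%N, #|R| = n.+1, r \in R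
      & forall S, closed_under e J S -> r \in S -> R \subset S].
Proof.
elim: n => [|n IHn] lt_n.
  exists set0, [set r]; rewrite cards0 cards1 set11; split=> // S _ rS.
  by rewrite sub1set.
have [J [R [leJ cardR rR JR]]] := IHn (ltnW lt_n).
(* [R] is nonempty and proper, so some edge [x -> y] of some digraph [i] leaves it. *)
have : ~~ closed_under e [set: I] R.
  apply/negP=> /e_strong[R0|RT]; first by rewrite R0 inE in rR.
  by rewrite RT cardsT in cardR; rewrite cardR ltnn in lt_n.
rewrite negb_forall_in => /exists_inP[i _].
rewrite negb_forall_in => /exists_inP[x xR].
rewrite negb_forall => /existsP[y]; rewrite negb_imply => /andP[exy yR].
exists (i |: J), (y |: R); split.
- by rewrite cardsU1 (leq_add (leq_b1 _) leJ).
- by rewrite cardsU1 yR cardR.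
- by rewrite inE rR orbT.
move=> S /closed_underP clS rS.
have RS : R \subset S.
  apply: JR rS; apply/closed_underP=> k z t kJ.
  by apply: clS; rewrite inE kJ orbT.
by rewrite subUset sub1set RS (clS i x y) ?setU11 ?(subsetP RS).
Qed.

Lemma spanning_family (r : T) :
  exists J : {set I}, (#|J| <= #|T|.-1)%N /\
    forall S, closed_under e J S -> r \in S -> S = [set: T].
Proof.
have T_gt0 : (0 < #|T|)%N by apply/card_gt0P; exists r.
have [|J [R [leJ cardR _ JR]]] := @spanning_family_grow r #|T|.-1.
  by rewrite prednK.
exists J; split=> // S clS rS; apply/eqP; rewrite -subTset.
suff <- : R = [set: T] by apply: JR.
by apply/eqP; rewrite eqEcard subsetT cardsT cardR leqSpred.
Qed.

End StronglyConnected.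

(** The out-tree family [J1] forces a closed set containing the root [r] to be everything. The
    in-tree family [J2] forces the complement of a closed set missing [r] to be everything. *)
Lemma strong_subfamily (I T : finType) (e : I -> rel T) :
  (forall S : {set T}, closed_under e [set: I] S -> S = set0 \/ S = [set: T]) ->
  exists J : {set I}, (#|J| <= (#|T|.-1).*2)%N /\
    forall S, closed_under e J S -> S = set0 \/ S = [set: T].
Proof.
move=> e_strong; have [r _|T0] := pickP (mem [set: T]); last first.
  exists set0; rewrite cards0; split=> // S _; left.
  by apply/setP=> x; have:= T0 x; rewrite /= inE.
have [J1 [leJ1 J1T]] := spanning_family e_strong r.
have [|J2 [leJ2 J2T]] := @spanning_family I T (fun i x y => e i y x) _ r.
  move=> S; rewrite closed_underC => /e_strong[] SC; [right|left].
    by rewrite -[S]setCK SC setC0.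
  by rewrite -[S]setCK SC setCT.
exists (J1 :|: J2); split.
  by rewrite -addnn (leq_trans (leq_card_setU _ _)) ?leq_add.
move=> S clS.
have sub (J : {set I}) : J \subset J1 :|: J2 -> closed_under e J S.
  move=> sJ; apply/closed_underP=> i x y iJ.
  by move/closed_underP: clS; apply; apply: (subsetP sJ).
have [rS|rS] := boolP (r \in S); [right|left].
  by apply: J1T rS; apply/sub/subsetUl.
rewrite -[S]setCK (J2T (~: S)) ?setCT ?inE // closed_underC setCK.
exact/sub/subsetUr.
Qed.

Section Eigenbasis.

Variables (K : fieldType) (V : vectType K) (B : 'End(V)) (d : nat).
Variables (v : 'I_d -> V) (a : 'I_d -> K).
Hypotheses (a_inj : injective a) (v_eigen : forall i, eigenvector B (a i) (v i)).

(* Applying the product of the [B - a k] over [k != j] kills every term but the j-th. *)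
Lemma eigen_component_mem (H : {vspace V}) (c : 'I_d -> K) (j : 'I_d) :
  invariant_subspace B H -> \sum_i c i *: v i \in H -> c j *: v j \in H.
Proof.
move=> BH sumH.
have shiftH (s : seq 'I_d) :
    \sum_i (c i * \prod_(k <- s) (a i - a k)) *: v i \in H.
  elim: s => [|k s IHs].
    by under eq_bigr => i _ do rewrite big_nil mulr1.
  set u := \sum_i _ in IHs.
  have Bu : B u \in H by apply: (subvP BH); apply: memv_img.
  suff -> : \sum_i (c i * \prod_(l <- k :: s) (a i - a l)) *: v i
            = B u - a k *: u by rewrite rpredB ?rpredZ.
  rewrite /u linear_sum scaler_sumr -sumrB; apply: eq_bigr => i _.
  rewrite big_cons linearZ /= (v_eigen i).2 !scalerA -scalerBl.
  by rewrite mulrCA mulrBl [_ * a i]mulrC.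
have := shiftH (enum [pred k | k != j]).
rewrite (bigD1 j) //= [X in _ + X]big1 => [|i ij].
  rewrite addr0 mulrC -scalerA rpredZeq => /orP[|//].
  rewrite prodf_seq_eq0 => /hasP[k].
  by rewrite mem_enum inE subr_eq0 => kj /eqP/a_inj jk; rewrite jk eqxx in kj.
rewrite (_ : \prod_(k <- _) _ = 0) ?mulr0 ?scale0r //.
apply/eqP; rewrite prodf_seq_eq0; apply/hasP; exists i.
  by rewrite mem_enum.
by rewrite subrr eqxx.
Qed.

(** The zero subspace is invariant, so every term of a vanishing combination lies in it. *)
Lemma eigenvectors_free : free [tuple v i | i < d].
Proof.
apply/freeP=> c sum0 j.
have : c j *: v j \in 0%VS.
  apply: eigen_component_mem; first by rewrite /invariant_subspace limg0.
  rewrite memv0 -{2}sum0; apply/eqP/eq_bigr => i _.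
  by rewrite -tnth_nth tnth_mktuple.
by rewrite memv0 scaler_eq0 (negPf (v_eigen j).1) orbF => /eqP.
Qed.

Hypothesis dimV : \dim {:V} = d.

Lemma eigenvectors_coord (u : V) :
  u = \sum_i coord [tuple v i | i < d] i u *: v i.
Proof.
have span_v : <<[tuple v i | i < d]>>%VS = fullv.
  apply/eqP; rewrite eqEdim subvf dimV.
  by move/eqP: eigenvectors_free => ->; rewrite size_tuple leqnn.
rewrite {1}[u](@coord_span _ _ _ [tuple v i | i < d]) ?span_v ?memvf //.
by apply: eq_bigr => i _; rewrite -tnth_nth tnth_mktuple.
Qed.

End Eigenbasis.

Theorem theorem3 (K : fieldType) (d : nat) (hd : (2 <= d)%N)
    (I : finType) (A : I -> 'End('rV[K]_d)) (i0 : I)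
    (hA0 : has_distinct_eigenvectors (A i0) d)
    (hsmall : forall J : {set I}, (#|J| <= 2 * d - 1)%N ->
      exists H : {vspace 'rV[K]_d}, common_nontrivial_invariant A J H) :
  exists H : {vspace 'rV[K]_d}, common_nontrivial_invariant A [set: I] H.
Proof.
have [v [a [a_inj v_eigen]]] := hA0.
have dimV : \dim {:'rV[K]_d} = d by rewrite dimvf /dim /= mul1n.
pose X := [tuple v i | i < d].
have coordE := eigenvectors_coord a_inj v_eigen dimV.
pose e i : rel 'I_d := fun j k => coord X k (A i (v j)) != 0.
(* If such an [S] exists, the eigenvectors it indexes span the required subspace. Otherwise
   [strong_subfamily] applies. *)
have [/existsP[S /and3P[S0 ST clS]]|noS] := boolP [exists S : {set 'I_d},
    [&& S != set0, S != [set: 'I_d] & closed_under e [set: I] S]].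
  exists <<[seq v j | j in S]>>%VS; split; first (apply/andP; split).
  - case/set0Pn: S0 => j jS; apply: contra (v_eigen j).1 => /eqP H0.
    by rewrite -memv0 -H0 memv_span ?image_f.
  (* A full span needs at least [d] generators, which forces [S] to be everything. *)
  - apply: contraNneq ST => HT.
    rewrite eqEcard subsetT cardsT card_ord -{1}dimV -HT.
    by rewrite (leq_trans (dim_span _)) // size_map -cardE.
  move=> i _; rewrite /invariant_subspace limg_span.
  apply/span_subvP=> _ /mapP[_ /imageP[j jS ->] ->].
  rewrite [A i _]coordE rpred_sum // => k _.
  have [-> |ejk] := eqVneq (coord X k (A i (v j))) 0.
    by rewrite scale0r mem0v.
  rewrite rpredZ ?memv_span ?image_f //.
  by move/closed_underP: clS => /(_ i j k); apply.
have [S clS|J [leJ J_strong]] := @strong_subfamily I 'I_d e.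
  have [-> |S0] := eqVneq S set0; first by left.
  have [-> |ST] := eqVneq S [set: 'I_d]; first by right.
  by case/existsP: noS; exists S; rewrite S0 ST.
(* The size is at most [1 + 2(d - 1) = 2d - 1]; including [i0] makes [H] invariant under [A i0], as
   [compH] requires. *)
have [|H [/andP[H0 HT] AH]] := hsmall (i0 |: J).
  rewrite card_ord in leJ; rewrite cardsU1.
  rewrite (leq_trans (leq_add (leq_b1 _) leJ)) //.
  by rewrite -(prednK (ltnW hd)) mul2n doubleS subn1 add1n.
have compH u k : u \in H -> coord X k u != 0 -> v k \in H.
  move=> uH uk.
  have : coord X k u *: v k \in H.
    apply: (eigen_component_mem (c := fun i => coord X i u) a_inj v_eigen).
      by apply: AH; rewrite setU11.
    by rewrite -coordE.
  by rewrite rpredZeq (negPf uk).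
(* By [compH] this index set is closed under the digraphs of [J]. If it is empty, all coordinates
   vanish on [H]; if it is full, [H] contains the whole eigenbasis. Both contradict
   non-triviality. *)
have [|S0|ST] := J_strong [set j | v j \in H].
- apply/closed_underP=> i j k iJ; rewrite !inE => jH; apply: compH.
  have AiH : invariant_subspace (A i) H by apply: AH; rewrite inE iJ orbT.
  by apply: (subvP AiH); apply: memv_img.
- case/eqP: H0; apply/eqP; rewrite -subv0; apply/subvP=> u uH.
  rewrite [u]coordE big1 ?mem0v // => j _.
  have [-> |/(compH _ _ uH) vH] := eqVneq (coord X j u) 0; first exact: scale0r.
  by move/setP/(_ j): S0; rewrite !inE vH.
- case/eqP: HT; apply/eqP; rewrite eqEsubv subvf; apply/subvP=> u _.
  rewrite [u]coordE rpred_sum // => j _; rewrite rpredZ //.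
  by move/setP/(_ j): ST; rewrite !inE.
Qed.
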